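(* Let $\mathbb{A},\mathbb{B},\mathbb{C}$ be algebraic structures. Let $(\theta_{\mathbb{A},\mathbb{B}})\colon(\Gamma_1,\bar p_1,\mu_{\Gamma_1})\to(\Gamma_2,\bar p_2,\mu_{\Gamma_2})$ be a strong homotopy of interpretations of $\mathbb{A}$ in $\mathbb{B}$ and $(\theta_{\mathbb{B},\mathbb{C}})\colon(\Delta_1,\bar q_1,\mu_{\Delta_1})\to(\Delta_2,\bar q_2,\mu_{\Delta_2})$ be a strong homotopy of interpretations of $\mathbb{B}$ in $\mathbb{C}$. Then there exists a strong homotopy $$(\Gamma_1\circ\Delta_1,(\bar{\bar p}_1,\bar q_1),\mu_{\Gamma_1}\circ\mu_{\Delta_1})\to(\Gamma_2\circ\Delta_2,(\bar{\bar p}_2,\bar q_2),\mu_{\Gamma_2}\circ\mu_{\Delta_2})$$ of interpretations of $\mathbb{A}$ in $\mathbb{C}$ (denoted $(\theta_{\mathbb{B},\mathbb{C}}\ast\theta_{\mathbb{A},\mathbb{B}})$).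
   Context: **Structures and codes.** $\mathbb{A}=\langle A;L(\mathbb{A})\rangle$ denotes a first-order structure with non-empty underlying set $A$ in the language $L(\mathbb{A})$ (logic with equality; constant, function and predicate symbols); similarly for other letters. Formulas of $L(\mathbb{B})\cup B$ are $L(\mathbb{B})$-formulas with parameters in $B$. Maps are applied to tuples coordinatewise. An interpretation code $\Gamma\colon L(\mathbb{A})\to L(\mathbb{B})$ is a family of $L(\mathbb{B})$-formulas $U_\Gamma(\bar x,\bar y)$, $E_\Gamma(\bar x,\bar x',\bar y)$, $c_\Gamma(\bar x,\bar y)$, $f_\Gamma(\bar x_0,\bar x_1,\ldots,\bar x_{n_f},\bar y)$, $R_\Gamma(\bar x_1,\ldots,\bar x_{n_R},\bar y)$, one for each constant symbol $c$, function symbol $f$, predicate symbol $R$ of $L(\mathbb{A})$, where all tuples $\bar x,\bar x',\bar x_i$ have the same length $\dim\Gamma$ and $|\bar y|=\dim_{\mathrm{par}}\Gamma$. For a tuple $\bar p$ from $B$ with $|\bar p|=\dim_{\mathrm{par}}\Gamma$ put $U_\Gamma(\mathbb{B},\bar p)=\{\bar b\mid\mathbb{B}\models U_\Gamma(\bar b,\bar p)\}$. The $L(\mathbb{A})$-structure $\Gamma(\mathbb{B},\bar p)$ is well-defined if $U_\Gamma(\mathbb{B},\bar p)\neq\emptyset$ and, on $U_\Gamma(\mathbb{B},\bar p)$, $E_\Gamma(\cdot,\cdot,\bar p)$ defines an equivalence relation $\sim_\Gamma$, each $c_\Gamma$ defines exactly one $\sim_\Gamma$-class, each $f_\Gamma$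 defines (the preimage of) the graph $x_0=f(x_1,\ldots,x_{n_f})$ of an operation on $U_\Gamma(\mathbb{B},\bar p)/{\sim_\Gamma}$, and each $R_\Gamma$ defines (the preimage of) a relation on $U_\Gamma(\mathbb{B},\bar p)/{\sim_\Gamma}$; then $\Gamma(\mathbb{B},\bar p)$ is the resulting structure on $U_\Gamma(\mathbb{B},\bar p)/{\sim_\Gamma}$. An interpretation $(\Gamma,\bar p,\mu_\Gamma)\colon\mathbb{A}\rightsquigarrow\mathbb{B}$ consists of a code $\Gamma$, a tuple $\bar p$ such that $\Gamma(\mathbb{B},\bar p)$ is well-defined, and a surjection (coordinate map) $\mu_\Gamma\colon U_\Gamma(\mathbb{B},\bar p)\to A$ that induces an $L(\mathbb{A})$-isomorphism $\bar\mu_\Gamma\colon\Gamma(\mathbb{B},\bar p)\to\mathbb{A}$, $\bar\mu_\Gamma(\bar b/{\sim_\Gamma})=\mu_\Gamma(\bar b)$. **Translations.** A formula is in normal form if it is prenex and its matrix is a disjunction of conjunctions of unnested atomic formulas ($x=x'$, $x=c$, $f(x_1,\ldots,x_{n_f})=x_0$, $R(x_1,\ldots,x_{n_R})$) and their negations. For an $L(\mathbb{A})$-formula $\psi(x_1,\ldots,x_s)$ in normal form, $\psi_\Gamma(\bar x_1,\ldots,\bar x_s,\bar y)$ is the $L(\mathbb{B})$-formula obtained by replacing each variable by a tuple of $\dim\Gamma$ variables, replacing the unnested atomic formulas by $E_\Gamma,c_\Gamma,f_\Gamma,R_\Gamma$ respectively, relativizing all quantifiers to $U_\Gamma(\cdot,\bar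 y)$, and adding the conjuncts $U_\Gamma(\bar x_i,\bar y)$ for all listed free variables. A formula not in normal form is translated via a logically equivalent normal form. **Composition.** For codes $\Gamma\colon L(\mathbb{A})\to L(\mathbb{B})$ and $\Delta\colon L(\mathbb{B})\to L(\mathbb{C})$, the code $\Gamma\circ\Delta\colon L(\mathbb{A})\to L(\mathbb{C})$ consists of the $\Delta$-translations $(U_\Gamma)_\Delta,(E_\Gamma)_\Delta,(c_\Gamma)_\Delta,(f_\Gamma)_\Delta,(R_\Gamma)_\Delta$; $\dim\Gamma\circ\Delta=\dim\Gamma\cdot\dim\Delta$, $\dim_{\mathrm{par}}\Gamma\circ\Delta=\dim_{\mathrm{par}}\Gamma\cdot\dim\Delta+\dim_{\mathrm{par}}\Delta$. The composition of interpretations $(\Gamma,\bar p,\mu_\Gamma)\colon\mathbb{A}\rightsquigarrow\mathbb{B}$ and $(\Delta,\bar q,\mu_\Delta)\colon\mathbb{B}\rightsquigarrow\mathbb{C}$ is the interpretation $(\Gamma\circ\Delta,(\bar{\bar p},\bar q),\mu_\Gamma\circ\mu_\Delta)\colon\mathbb{A}\rightsquigarrow\mathbb{C}$, where $\bar{\bar p}\in\mu_\Delta^{-1}(\bar p)$ (any choice). **Strong homotopy.** A strong homotopy $(\theta)\colon(\Gamma_1,\bar p_1,\mu_{\Gamma_1})\to(\Gamma_2,\bar p_2,\mu_{\Gamma_2})$ of interpretations of $\mathbb{A}$ in $\mathbb{B}$ is given by a formula $\theta$ of $L(\mathbb{B})\cup B$ (connector) which defines in $\mathbb{B}$ (the preimage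 of the graph of) an $L(\mathbb{A})$-isomorphism $\lambda\colon\Gamma_1(\mathbb{B},\bar p_1)\to\Gamma_2(\mathbb{B},\bar p_2)$ with $\bar\mu_{\Gamma_1}=\bar\mu_{\Gamma_2}\circ\lambda$. *)

(* Defs.v *)
From mathcomp Require Import all_boot matrix boolp.

Set Implicit Arguments.
Unset Strict Implicit.
Unset Printing Implicit Defensive.

Record language := Language {
  csym : Type;
  fsym : Type;
  psym : Type;
  farity : fsym -> nat;
  parity : psym -> nat
}.

(* A tuple of length n over X is a function 'I_n -> X. *)
Record structure (L : language) := Structure_ {
  carrier :> Type;
  carrier_inh : inhabited carrier;
  cint : csym L -> carrier;
  fint : forall f : fsym L, ('I_(farity f) -> carrier) -> carrier;
  pint : forall R : psym L, ('I_(parity R) -> carrier) -> Prop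
}.

Definition isomorphism (L : language) (M N : structure L) (h : M -> N) : Prop :=
  [/\ bijective h,
      forall c : csym L, h (cint M c) = cint N c,
      forall (f : fsym L) (xs : 'I_(farity f) -> M),
        h (fint xs) = fint (fun i => h (xs i))
    & forall (R : psym L) (xs : 'I_(parity R) -> M),
        pint xs <-> pint (fun i => h (xs i))].

Inductive term (L : language) (V : Type) : Type :=
| Var of V
| Cst of csym L
| App (f : fsym L) of 'I_(farity f) -> term L V.

Arguments Var {L V} _.
Arguments Cst {L V} _.
Arguments App {L V} f _.

(* Formulas whose free variables are drawn from the type V; a quantifier binds
   the variable None of option V. *)
Inductive formula (L : language) (V : Type) : Type :=
| Eq of term L V & term L V
| Pred (R : psym L) of 'I_(parity R) -> term L V
| Not of formula L V
| And of formula L V & formula L V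
| Or of formula L V & formula L V
| Imp of formula L V & formula L V
| Ex of formula L (option V)
| All of formula L (option V).

Arguments Pred {L V} R _.

Fixpoint eval (L : language) (M : structure L) (V : Type) (rho : V -> M)
    (t : term L V) : M :=
  match t with
  | Var x => rho x
  | Cst c => cint M c
  | App f ts => fint (fun i => eval rho (ts i))
  end.

Definition extend (V X : Type) (rho : V -> X) (a : X) : option V -> X :=
  fun v => if v is Some x then rho x else a.

Fixpoint sat (L : language) (M : structure L) (V : Type) (phi : formula L V) :
    (V -> M) -> Prop :=
  match phi with
  | Eq t u => fun rho => eval rho t = eval rho u
  | Pred R ts => fun rho => pint (fun i => eval rho (ts i))
  | Not phi1 => fun rho => ~ sat phi1 rho
  | And phi1 phi2 => fun rho => sat phi1 rho /\ sat phi2 rho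
  | Or phi1 phi2 => fun rho => sat phi1 rho \/ sat phi2 rho
  | Imp phi1 phi2 => fun rho => sat phi1 rho -> sat phi2 rho
  | Ex phi1 => fun rho => exists a : M, sat phi1 (extend rho a)
  | All phi1 => fun rho => forall a : M, sat phi1 (extend rho a)
  end.

Definition logically_equivalent (L : language) (V : Type)
    (phi psi : formula L V) : Prop :=
  forall (M : structure L) (rho : V -> M), sat phi rho <-> sat psi rho.

Fixpoint trename (L : language) (V W : Type) (h : V -> W) (t : term L V) :
    term L W :=
  match t with
  | Var x => Var (h x)
  | Cst c => Cst c
  | App f ts => App f (fun i => trename h (ts i))
  end.

Fixpoint rename (L : language) (V W : Type) (h : V -> W) (phi : formula L V) :
    formula L W :=
  match phi with
  | Eq t u => Eq (trename h t) (trename h u)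
  | Pred R ts => Pred R (fun i => trename h (ts i))
  | Not phi1 => Not (rename h phi1)
  | And phi1 phi2 => And (rename h phi1) (rename h phi2)
  | Or phi1 phi2 => Or (rename h phi1) (rename h phi2)
  | Imp phi1 phi2 => Imp (rename h phi1) (rename h phi2)
  | Ex phi1 => Ex (rename (omap h) phi1)
  | All phi1 => All (rename (omap h) phi1)
  end.

Definition unblock0 (V : Type) (v : V + 'I_0) : V :=
  match v with
  | inl x => x
  | inr i => match notF (ltn_ord i) with end
  end.

Definition unblockS (V : Type) (n : nat) (v : V + 'I_n.+1) : option V + 'I_n :=
  match v with
  | inl x => inl (Some x)
  | inr i => if unlift ord0 i is Some j then inr j else inl None
  end.

Fixpoint Exn (L : language) (n : nat) :
    forall V : Type, formula L (V + 'I_n) -> formula L V :=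
  match n with
  | 0 => fun V phi => rename (@unblock0 V) phi
  | m.+1 => fun V phi => Ex (Exn (rename (@unblockS V m) phi))
  end.

Fixpoint Alln (L : language) (n : nat) :
    forall V : Type, formula L (V + 'I_n) -> formula L V :=
  match n with
  | 0 => fun V phi => rename (@unblock0 V) phi
  | m.+1 => fun V phi => All (Alln (rename (@unblockS V m) phi))
  end.

Inductive atom (L : language) (V : Type) : Type :=
| AEq of V & V
| ACst of V & csym L
| AFun (f : fsym L) of 'I_(farity f) -> V & V
| APred (R : psym L) of 'I_(parity R) -> V.

Inductive literal (L : language) (V : Type) : Type :=
| LPos of atom L V
| LNeg of atom L V.

Inductive conjunction (L : language) (V : Type) : Type :=
| CLit of literal L V
| CAnd of conjunction L V & conjunction L V.

Inductive disjunction (L : language) (V : Type) : Type :=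
| DConj of conjunction L V
| DOr of disjunction L V & disjunction L V.

Inductive nform (L : language) (V : Type) : Type :=
| NMatrix of disjunction L V
| NEx of nform L (option V)
| NAll of nform L (option V).

Arguments AEq {L V}.
Arguments ACst {L V}.
Arguments AFun {L V}.
Arguments APred {L V}.

Section NormalFormsAsFormulas.
Variable L : language.

Definition atom_formula (V : Type) (a : atom L V) : formula L V :=
  match a with
  | AEq x x' => Eq (Var x) (Var x')
  | ACst x c => Eq (Var x) (Cst c)
  | AFun f xs x0 => Eq (App f (fun i => Var (xs i))) (Var x0)
  | APred R xs => Pred R (fun i => Var (xs i))
  end.

Definition literal_formula (V : Type) (l : literal L V) : formula L V :=
  match l with
  | LPos a => atom_formula a
  | LNeg a => Not (atom_formula a)
  end.

Fixpoint conjunction_formula (V : Type) (k : conjunction L V) : formula L V :=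
  match k with
  | CLit l => literal_formula l
  | CAnd k1 k2 => And (conjunction_formula k1) (conjunction_formula k2)
  end.

Fixpoint disjunction_formula (V : Type) (d : disjunction L V) : formula L V :=
  match d with
  | DConj k => conjunction_formula k
  | DOr d1 d2 => Or (disjunction_formula d1) (disjunction_formula d2)
  end.

Fixpoint nform_formula (V : Type) (psi : nform L V) : formula L V :=
  match psi with
  | NMatrix d => disjunction_formula d
  | NEx psi1 => Ex (nform_formula psi1)
  | NAll psi1 => All (nform_formula psi1)
  end.

End NormalFormsAsFormulas.

(* A choice of an equivalent normal form for every formula in finitely many
   listed variables; formulas already in normal form are left unchanged. *)
Record normalizer (L : language) := Normalizer {
  nf :> forall V : finType, formula L V -> nform L V;
  nf_equivalent : forall (V : finType) (phi : formula L V),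
    logically_equivalent phi (nform_formula (nf phi));
  nf_normal : forall (V : finType) (psi : nform L V),
    nform_formula (nf (nform_formula psi)) = nform_formula psi
}.

(* Variables of a family, indexed by W, of d-tuples of variables, followed by a
   k-tuple of parameter variables. *)
Definition cvar (d k : nat) (W : Type) : Type := ((W * 'I_d) + 'I_k)%type.

(* The tuple variables are indexed by unit (U and c), by bool (E, with false for
   the first tuple), by option 'I_n (f, with None for the value x0 and Some i
   for the arguments) and by 'I_n (R). *)
Record code (L L' : language) := Code {
  dim : nat;
  dimpar : nat;
  code_U : formula L' (cvar dim dimpar unit);
  code_E : formula L' (cvar dim dimpar bool);
  code_c : csym L -> formula L' (cvar dim dimpar unit);
  code_f : forall f : fsym L,
    formula L' (cvar dim dimpar (option 'I_(farity f)));
  code_R : forall R : psym L, formula L' (cvar dim dimpar 'I_(parity R))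
}.

Definition assign (d k : nat) (W X : Type) (bs : W -> 'I_d -> X)
    (p : 'I_k -> X) : cvar d k W -> X :=
  fun v => match v with inl (w, i) => bs w i | inr j => p j end.

Section InterpretedStructure.
Variables (L L' : language) (Gam : code L L') (B : structure L').
Variable p : 'I_(dimpar Gam) -> B.

Definition in_U (b : 'I_(dim Gam) -> B) : Prop :=
  sat (code_U Gam) (assign (fun=> b) p).

Definition domU : Type := {b : 'I_(dim Gam) -> B | in_U b}.

Definition simE (b b' : domU) : Prop :=
  sat (code_E Gam) (assign (fun s : bool => sval (if s then b' else b)) p).

Definition quoU : Type := {S : domU -> Prop | exists b, S = simE b}.

Definition class (b : domU) : quoU :=
  exist _ (simE b) (ex_intro (fun b' => simE b = simE b') b erefl).

Definition repr (s : quoU) : domU := sval (cid (svalP s)).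

Definition defines_constant (c : csym L) (s : quoU) : Prop :=
  forall b : domU,
    sat (code_c Gam c) (assign (fun=> sval b) p) <-> class b = s.

Definition defines_operation (f : fsym L)
    (op : ('I_(farity f) -> quoU) -> quoU) : Prop :=
  forall (b0 : domU) (bs : 'I_(farity f) -> domU),
    sat (code_f Gam f) (assign (fun v => sval (oapp bs b0 v)) p)
    <-> class b0 = op (fun i => class (bs i)).

Definition defines_relation (R : psym L)
    (rel : ('I_(parity R) -> quoU) -> Prop) : Prop :=
  forall bs : 'I_(parity R) -> domU,
    sat (code_R Gam R) (assign (fun i => sval (bs i)) p)
    <-> rel (fun i => class (bs i)).

Record well_defined : Prop := WellDefined {
  wd_inh : inhabited domU;
  wd_refl : forall b, simE b b;
  wd_sym : forall b b', simE b b' -> simE b' b;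
  wd_trans : forall b b' b'', simE b b' -> simE b' b'' -> simE b b'';
  wd_c : forall c : csym L, exists s, defines_constant c s;
  wd_f : forall f : fsym L, exists op, @defines_operation f op;
  wd_R : forall R : psym L, exists rel, @defines_relation R rel
}.

Definition interpreted (wd : well_defined) : structure L :=
  {| carrier := quoU;
     carrier_inh := let: inhabits b := wd_inh wd in inhabits (class b);
     cint := fun c => sval (cid (wd_c wd c));
     fint := fun f => sval (cid (wd_f wd f));
     pint := fun R => sval (cid (wd_R wd R)) |}.

End InterpretedStructure.

(* The coordinate map is given as a total map on tuples, of which only the
   values on the domain U matter. *)
Record interp_triple (L L' : language) (A : structure L) (B : structure L') :=
  InterpTriple {
    icode : code L L';
    ipar : 'I_(dimpar icode) -> B;
    icoord : ('I_(dim icode) -> B) -> A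
  }.

Arguments ipar {L L' A B} i _.
Arguments icoord {L L' A B} i _.

Definition induced_map (L L' : language) (A : structure L) (B : structure L')
    (I : interp_triple A B) (s : quoU (ipar I)) : A :=
  icoord I (sval (repr s)).

Arguments induced_map {L L' A B} I s.

Definition is_interpretation (L L' : language) (A : structure L)
    (B : structure L') (I : interp_triple A B) : Prop :=
  exists wd : well_defined (ipar I),
    [/\ forall a : A, exists b : domU (ipar I), icoord I (sval b) = a,
        forall b : domU (ipar I),
          induced_map I (class b) = icoord I (sval b)
      & isomorphism (induced_map I : interpreted wd -> A)].

Section Translation.
Variables (L L' : language) (Gam : code L L').
Let d := dim Gam.
Let k := dimpar Gam.

Definition inst (W V : Type) (h : W -> V) : cvar d k W -> cvar d k V :=
  fun v => match v with inl (w, i) => inl (h w, i) | inr j => inr j end.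

Definition tr_U (V : Type) (x : V) : formula L' (cvar d k V) :=
  rename (inst (fun=> x)) (code_U Gam).

Definition tr_atom (V : Type) (a : atom L V) : formula L' (cvar d k V) :=
  match a with
  | AEq x x' => rename (inst (fun s : bool => if s then x' else x)) (code_E Gam)
  | ACst x c => rename (inst (fun=> x)) (code_c Gam c)
  | AFun f xs x0 => rename (inst (oapp xs x0)) (code_f Gam f)
  | APred R xs => rename (inst xs) (code_R Gam R)
  end.

Definition tr_literal (V : Type) (l : literal L V) : formula L' (cvar d k V) :=
  match l with
  | LPos a => tr_atom a
  | LNeg a => Not (tr_atom a)
  end.

Fixpoint tr_conjunction (V : Type) (c : conjunction L V) :
    formula L' (cvar d k V) :=
  match c with
  | CLit l => tr_literal l
  | CAnd c1 c2 => And (tr_conjunction c1) (tr_conjunction c2)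
  end.

Fixpoint tr_disjunction (V : Type) (e : disjunction L V) :
    formula L' (cvar d k V) :=
  match e with
  | DConj c => tr_conjunction c
  | DOr e1 e2 => Or (tr_disjunction e1) (tr_disjunction e2)
  end.

Definition isolate (V : Type) (v : cvar d k (option V)) : cvar d k V + 'I_d :=
  match v with
  | inl (Some x, i) => inl (inl (x, i))
  | inl (None, i) => inr i
  | inr j => inl (inr j)
  end.

Fixpoint tr_nform (V : Type) (psi : nform L V) : formula L' (cvar d k V) :=
  match psi with
  | NMatrix e => tr_disjunction e
  | NEx psi1 => Exn (rename (@isolate V) (And (tr_U None) (tr_nform psi1)))
  | NAll psi1 => Alln (rename (@isolate V) (Imp (tr_U None) (tr_nform psi1)))
  end.

Definition translate (V : finType) (psi : nform L V) :
    formula L' (cvar d k V) :=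
  foldl (fun chi x => And chi (tr_U x)) (tr_nform psi) (enum V).

End Translation.

Section Composition.
Variables (L L' L'' : language) (N : normalizer L').
Variables (Gam : code L L') (Del : code L' L'').

(* A tuple of m tuples of length n is flattened to length m * n along
   mxvec_index. *)
Definition flatten_var (W : Type)
    (v : cvar (dim Del) (dimpar Del) (cvar (dim Gam) (dimpar Gam) W)) :
    cvar (dim Gam * dim Del) (dimpar Gam * dim Del + dimpar Del) W :=
  match v with
  | inl (inl (w, i), j) => inl (w, mxvec_index i j)
  | inl (inr l, j) => inr (lshift (dimpar Del) (mxvec_index l j))
  | inr l => inr (rshift (dimpar Gam * dim Del) l)
  end.

Definition comp_formula (W : finType)
    (phi : formula L' (cvar (dim Gam) (dimpar Gam) W)) :
    formula L'' (cvar (dim Gam * dim Del) (dimpar Gam * dim Del + dimpar Del) W) :=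
  rename (@flatten_var W)
    (translate Del (N ((W * 'I_(dim Gam)) + 'I_(dimpar Gam))%type phi)).

Definition comp_code : code L L'' :=
  {| dim := dim Gam * dim Del;
     dimpar := dimpar Gam * dim Del + dimpar Del;
     code_U := comp_formula (code_U Gam);
     code_E := comp_formula (code_E Gam);
     code_c := fun c => comp_formula (code_c Gam c);
     code_f := fun f => comp_formula (code_f Gam f);
     code_R := fun R => comp_formula (code_R Gam R) |}.

End Composition.

Section CompositionOfInterpretations.
Variables (L L' L'' : language).
Variables (A : structure L) (B : structure L') (C : structure L'').

(* pp is a tuple of preimages of ps under the coordinate map of J. *)
Definition lifts (J : interp_triple B C) (m : nat) (ps : 'I_m -> B)
    (pp : 'I_(m * dim (icode J)) -> C) : Prop :=
  forall l : 'I_m,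
    in_U (ipar J) (fun j => pp (mxvec_index l j))
    /\ icoord J (fun j => pp (mxvec_index l j)) = ps l.

Definition comp_triple (N : normalizer L') (I : interp_triple A B)
    (J : interp_triple B C)
    (pp : 'I_(dimpar (icode I) * dim (icode J)) -> C) : interp_triple A C :=
  {| icode := comp_code N (icode I) (icode J);
     ipar := fun l : 'I_(_ + _) =>
       match split l with inl u => pp u | inr v => ipar J v end;
     icoord := fun cs : 'I_(_ * _) -> C =>
       icoord I (fun i => icoord J (fun j => cs (mxvec_index i j))) |}.

End CompositionOfInterpretations.

Arguments lifts {L' L'' B C} J {m} ps pp.
Arguments comp_triple {L L' L'' A B C} N I J pp.

(* A formula with parameters in B: an element of B standing for a variable
   denotes itself. *)
Definition connector (L L' : language) (A : structure L) (B : structure L')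
    (I1 I2 : interp_triple A B) : Type :=
  formula L' (('I_(dim (icode I1)) + 'I_(dim (icode I2))) + B)%type.

Definition strong_homotopy (L L' : language) (A : structure L)
    (B : structure L') (I1 I2 : interp_triple A B) (theta : connector I1 I2) :
    Prop :=
  [/\ is_interpretation I1, is_interpretation I2
    & exists (wd1 : well_defined (ipar I1)) (wd2 : well_defined (ipar I2))
             (lam : interpreted wd1 -> interpreted wd2),
      [/\ isomorphism lam,
          forall s, induced_map I1 s = induced_map I2 (lam s)
        & forall (b1 : 'I_(dim (icode I1)) -> B) (b2 : 'I_(dim (icode I2)) -> B),
          sat theta (fun v => match v with
                              | inl (inl i) => b1 i
                              | inl (inr j) => b2 j
                              | inr r => r
                              end)
          <-> exists (h1 : in_U (ipar I1) b1) (h2 : in_U (ipar I2) b2),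
                lam (class (exist _ b1 h1)) = class (exist _ b2 h2)]].

Section NormalFormsExist.
Variable L : language.

Definition nf_definable (V : Type)
    (P : forall M : structure L, (V -> M) -> Prop) : Prop :=
  exists psi : nform L V,
    forall (M : structure L) (rho : V -> M),
      sat (nform_formula psi) rho <-> P M rho.

Definition dnf_definable (V : Type)
    (P : forall M : structure L, (V -> M) -> Prop) : Prop :=
  exists e : disjunction L V,
    forall (M : structure L) (rho : V -> M),
      sat (disjunction_formula e) rho <-> P M rho.

Lemma eval_trename (M : structure L) (V W : Type) (h : V -> W) (t : term L V)
    (rho : W -> M) :
  eval rho (trename h t) = eval (fun v => rho (h v)) t.
Proof.
elim: t => //= f ts IH; congr fint; apply: funext => i; exact: IH.
Qed.

Lemma extend_omap (V W X : Type) (h : V -> W) (rho : W -> X) (a : X) :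
  (fun v => extend rho a (omap h v)) = extend (fun v => rho (h v)) a.
Proof. by apply: funext => -[]. Qed.

Lemma sat_rename (M : structure L) (V : Type) (phi : formula L V) :
  forall (W : Type) (h : V -> W) (rho : W -> M),
  sat (rename h phi) rho <-> sat phi (fun v => rho (h v)).
Proof.
elim: phi => {V} V /=.
- by move=> t u W h rho; rewrite !eval_trename.
- move=> R ts W h rho; under eq_fun do rewrite eval_trename; by [].
- by move=> phi IH W h rho; rewrite IH.
- by move=> phi IH psi IH' W h rho; rewrite IH IH'.
- by move=> phi IH psi IH' W h rho; rewrite IH IH'.
- by move=> phi IH psi IH' W h rho; rewrite IH IH'.
- by move=> phi IH W h rho; split=> -[a H]; exists a; move: H; rewrite IH extend_omap.
- by move=> phi IH W h rho; split=> H a; move: (H a); rewrite IH extend_omap.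
Qed.

Lemma dnf_or V P Q : @dnf_definable V P -> dnf_definable Q ->
  dnf_definable (fun M rho => P M rho \/ Q M rho).
Proof. by move=> [e He] [e' He']; exists (DOr e e') => M rho /=; rewrite He He'. Qed.

Lemma dnf_eq V P Q : @dnf_definable V P ->
  (forall M rho, P M rho <-> Q M rho) -> dnf_definable Q.
Proof. by move=> [e He] PQ; exists e => M rho; rewrite He. Qed.

Lemma nf_eq V P Q : @nf_definable V P ->
  (forall M rho, P M rho <-> Q M rho) -> nf_definable Q.
Proof. by move=> [e He] PQ; exists e => M rho; rewrite He. Qed.

Lemma dnf_and V P Q : @dnf_definable V P -> dnf_definable Q ->
  dnf_definable (fun M rho => P M rho /\ Q M rho).
Proof.
move=> [e He] [e' He'].
suff: dnf_definable (fun M rho => sat (disjunction_formula e) rho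
                               /\ sat (disjunction_formula e') rho).
  by move/dnf_eq; apply=> M rho; rewrite He He'.
elim: e {P He} => [k|e1 IH1 e2 IH2]; last first.
  by apply: dnf_eq (dnf_or IH1 IH2) _ => M rho /=; tauto.
elim: e' {Q He'} => [k'|e1 IH1 e2 IH2]; last first.
  by apply: dnf_eq (dnf_or IH1 IH2) _ => M rho /=; tauto.
by exists (DConj (CAnd k k')).
Qed.

Lemma dnf_not V P : @dnf_definable V P ->
  dnf_definable (fun M rho => ~ P M rho).
Proof.
move=> [e He].
suff: dnf_definable (fun M rho => ~ sat (disjunction_formula e) rho).
  by move/dnf_eq; apply=> M rho; rewrite He.
elim: e {P He} => [k|e1 IH1 e2 IH2]; last first.
  by apply: dnf_eq (dnf_and IH1 IH2) _ => M rho /=; tauto.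
elim: k => [l|k1 IH1 k2 IH2]; last first.
  apply: dnf_eq (dnf_or IH1 IH2) _ => M rho /=.
  by case: (EM (sat (conjunction_formula k1) rho)); tauto.
case: l => a; first by exists (DConj (CLit (LNeg a))).
exists (DConj (CLit (LPos a))) => M rho /=.
by case: (EM (sat (atom_formula a) rho)); tauto.
Qed.

Lemma nf_dnf V P : @dnf_definable V P -> nf_definable P.
Proof. by move=> [e He]; exists (NMatrix e). Qed.

Lemma nf_atom V (a : atom L V) :
  nf_definable (fun M rho => sat (atom_formula a) rho).
Proof. by exists (NMatrix (DConj (CLit (LPos a)))). Qed.

Lemma nf_ex V (P : forall M : structure L, (option V -> M) -> Prop) :
  nf_definable P -> nf_definable (fun M rho => exists a, P M (extend rho a)).
Proof.
move=> [psi H]; exists (NEx psi) => M rho /=.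
by split=> -[a /H Ha]; exists a.
Qed.

Lemma nf_all V (P : forall M : structure L, (option V -> M) -> Prop) :
  nf_definable P -> nf_definable (fun M rho => forall a, P M (extend rho a)).
Proof.
by move=> [psi H]; exists (NAll psi) => M rho /=; split=> Ha a; apply/H/Ha.
Qed.

Lemma nf_not V P : @nf_definable V P -> nf_definable (fun M rho => ~ P M rho).
Proof.
move=> [psi H].
suff: nf_definable (fun M rho => ~ sat (nform_formula psi) rho).
  by move/nf_eq; apply=> M rho; rewrite H.
elim: psi {P H} => {V} V.
- by move=> e; apply/nf_dnf/dnf_not; exists e.
- move=> psi IH; apply: nf_eq (nf_all IH) _ => M rho /=.
  by split=> [H [a /H]|H a Ha] //; apply: H; exists a.
- move=> psi IH; apply: nf_eq (nf_ex IH) _ => M rho /=.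
  split=> [[a Ha] /(_ a)//|H]; apply: contrapT => H'; apply: H => a.
  by apply: contrapT => Ha; apply: H'; exists a.
Qed.

Lemma dnf_rename V W (h : V -> W) P : @dnf_definable V P ->
  dnf_definable (fun M rho => P M (fun v => rho (h v))).
Proof.
move=> [e H].
suff: dnf_definable (fun M (rho : W -> M) =>
    sat (disjunction_formula e) (fun v => rho (h v))).
  by move/dnf_eq; apply=> M rho; rewrite H.
elim: e {P H} => [k|e1 IH1 e2 IH2]; last exact: dnf_or IH1 IH2.
elim: k => [l|k1 IH1 k2 IH2]; last exact: dnf_and IH1 IH2.
have Hat (a : atom L V) : dnf_definable (fun M (rho : W -> M) =>
    sat (atom_formula a) (fun v => rho (h v))).
  case: a => [x x'|x c|f xs x0|R xs].
  - by exists (DConj (CLit (LPos (AEq (h x) (h x'))))).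
  - by exists (DConj (CLit (LPos (ACst (h x) c)))).
  - by exists (DConj (CLit (LPos (AFun f (fun i => h (xs i)) (h x0))))).
  - by exists (DConj (CLit (LPos (APred R (fun i => h (xs i)))))).
by case: l => a; [apply: Hat | apply: dnf_not (Hat a)].
Qed.

Lemma nf_rename V W (h : V -> W) P : @nf_definable V P ->
  nf_definable (fun M rho => P M (fun v => rho (h v))).
Proof.
move=> [psi H].
suff: nf_definable (fun M (rho : W -> M) =>
    sat (nform_formula psi) (fun v => rho (h v))).
  by move/nf_eq; apply=> M rho; rewrite H.
elim: psi W h {P H} => {V} V.
- move=> e W h.
  have He : dnf_definable (fun M (rho : V -> M) => sat (disjunction_formula e) rho).
    by exists e.
  exact: nf_dnf (dnf_rename h He).
- move=> psi IH W h; apply: nf_eq (nf_ex (IH _ (omap h))) _ => M rho /=.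
  by split=> -[a Ha]; exists a; rewrite extend_omap in Ha *.
- move=> psi IH W h; apply: nf_eq (nf_all (IH _ (omap h))) _ => M rho /=.
  by split=> H a; move: (H a); rewrite extend_omap.
Qed.

Lemma nf_and_dnf V P Q : @nf_definable V P -> dnf_definable Q ->
  nf_definable (fun M rho => P M rho /\ Q M rho).
Proof.
move=> [psi H] HQ.
suff: nf_definable (fun M rho => sat (nform_formula psi) rho /\ Q M rho).
  by move/nf_eq; apply=> M rho; rewrite H.
elim: psi {P H} Q HQ => {V} V.
- by move=> e Q HQ; apply/nf_dnf/dnf_and => //; exists e.
- move=> psi IH Q /(dnf_rename Some) /IH /nf_ex HQ.
  by apply: nf_eq HQ _ => M rho /=; split=> [[a []]|[[a]]]; [split=> //|]; exists a.
- move=> psi IH Q /(dnf_rename Some) /IH /nf_all HQ.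
  apply: nf_eq HQ _ => M rho /=; split=> [H|[H HQ] a]; last by split.
  by have [a0] := carrier_inh M; split=> [a|]; [case: (H a)|case: (H a0)].
Qed.

Lemma nf_and V P Q : @nf_definable V P -> nf_definable Q ->
  nf_definable (fun M rho => P M rho /\ Q M rho).
Proof.
move=> [psi H] HQ.
suff: nf_definable (fun M rho => sat (nform_formula psi) rho /\ Q M rho).
  by move/nf_eq; apply=> M rho; rewrite H.
elim: psi {P H} Q HQ => {V} V.
- move=> e Q HQ.
  have He : dnf_definable (fun M rho => sat (disjunction_formula e) rho).
    by exists e.
  by apply: nf_eq (nf_and_dnf HQ He) _ => M rho /=; tauto.
- move=> psi IH Q /(nf_rename Some) /IH /nf_ex HQ.
  by apply: nf_eq HQ _ => M rho /=; split=> [[a []]|[[a]]]; [split=> //|]; exists a.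
- move=> psi IH Q /(nf_rename Some) /IH /nf_all HQ.
  apply: nf_eq HQ _ => M rho /=; split=> [H|[H HQ] a]; last by split.
  by have [a0] := carrier_inh M; split=> [a|]; [case: (H a)|case: (H a0)].
Qed.

Definition nf_graph V (t : term L V) : Prop :=
  nf_definable (fun M (rho : option V -> M) =>
    eval (fun v => rho (Some v)) t = rho None).

Lemma nf_subst V (t : term L V) P : nf_graph t ->
  @nf_definable (option V) P ->
  nf_definable (fun M rho => P M (extend rho (eval rho t))).
Proof.
move=> Ht HP; apply: nf_eq (nf_ex (nf_and Ht HP)) _ => M rho /=.
by split=> [[a [-> ]]|H] //; exists (eval rho t).
Qed.

Lemma graph_rename V W (h : V -> W) (t : term L V) :
  nf_graph t -> nf_graph (trename h t).
Proof.
move=> /(nf_rename (omap h)) /nf_eq; apply=> M rho.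
by rewrite eval_trename.
Qed.

Lemma nf_tuple n : forall V (ts : 'I_n -> term L V) P,
  (forall i, nf_graph (ts i)) -> @nf_definable (V + 'I_n) P ->
  nf_definable (fun M rho => P M (fun v =>
    match v with inl x => rho x | inr i => eval rho (ts i) end)).
Proof.
elim: n => [|n IH] V ts P Hts HP.
  apply: nf_eq (nf_rename (@unblock0 V) HP) _ => M rho.
  suff -> : (fun v => rho (unblock0 v)) = (fun v =>
    match v with inl x => rho x | inr i => eval rho (ts i) end) by [].
  by apply: funext => -[|[]].
have Hts' i : nf_graph (trename Some (ts (lift ord0 i))) by exact: graph_rename.
have := nf_subst (Hts ord0) (IH _ _ _ Hts' (nf_rename (@unblockS V n) HP)).
move/nf_eq; apply=> M rho.
set r1 := (fun v : V + 'I_n.+1 => _); set r2 := (fun v : V + 'I_n.+1 => _).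
suff -> : r1 = r2 by [].
apply: funext => -[x|i] //; rewrite /r1 /r2 /=.
by case: unliftP => [j|] -> //=; rewrite eval_trename.
Qed.

Lemma nf_term V (t : term L V) : nf_graph t.
Proof.
elim: t => [x|c|f ts IH].
- exact: nf_eq (nf_atom (AEq (Some x) None)) _.
- apply: nf_eq (nf_atom (ACst None c)) _ => M rho /=.
  by split=> ->.
- have H := nf_atom (@AFun L (option V + 'I_(farity f)) f inr (inl None)).
  apply: nf_eq (nf_tuple (fun i => graph_rename Some (IH i)) H) _ => M rho /=.
  by under eq_fun do rewrite eval_trename.
Qed.

Lemma nf_exists V (phi : formula L V) : nf_definable (fun M rho => sat phi rho).
Proof.
elim: phi => {V} V /=.
- move=> t u; apply: nf_eq (nf_subst (nf_term u) (nf_term t)) _ => M rho //.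
- move=> R ts; have H := nf_atom (@APred L (V + 'I_(parity R)) R inr).
  exact: nf_eq (nf_tuple (fun i => nf_term (ts i)) H) _.
- by move=> phi /nf_not.
- by move=> phi IH psi; apply: nf_and.
- move=> phi IH psi IH'.
  apply: nf_eq (nf_not (nf_and (nf_not IH) (nf_not IH'))) _ => M rho.
  by case: (EM (sat phi rho)); case: (EM (sat psi rho)); tauto.
- move=> phi IH psi IH'.
  apply: nf_eq (nf_not (nf_and IH (nf_not IH'))) _ => M rho.
  by case: (EM (sat phi rho)); case: (EM (sat psi rho)); tauto.
- by move=> phi /nf_ex.
- by move=> phi /nf_all.
Qed.

Lemma normalizer_exists : inhabited (normalizer L).
Proof.
have H (V : finType) (phi : formula L V) : exists psi : nform L V,
    logically_equivalent phi (nform_formula psi)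
    /\ ((exists psi', phi = nform_formula psi') -> phi = nform_formula psi).
  have [[psi' ->]|no] := EM (exists psi', phi = nform_formula psi').
    by exists psi'.
  by have [psi H] := nf_exists phi; exists psi; split=> // M rho; rewrite H.
constructor; exists (fun V phi => sval (cid (H V phi))) => V phi.
  by case: cid => psi [].
by case: cid => psi [/= _ <- //]; exists phi.
Qed.

End NormalFormsExist.

(* Main.v *)
From mathcomp Require Import all_boot matrix boolp.
Require Import Defs.

Set Implicit Arguments.
Unset Strict Implicit.
Unset Printing Implicit Defensive.

(** An interpretation of A in B is the same thing as a surjection mu from the
    set of tuples U onto A along which every atomic relation of A pulls back to
    the relation that the code defines ([is_interpretationP]): the quotient by E
    and the isomorphism induced on it carry no further information.  In the same
    way the isomorphism of a strong homotopy is forced to be the inverse of the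
    second induced map after the first one, so that a formula is a connector
    exactly when it defines the relation mu1 b1 = mu2 b2 on U1 * U2
    ([strong_homotopyP]).  The theorem becomes a statement about definability:
    for the composite interpretations, the relation
    mu_I1 (mu_J1 c1) = mu_I2 (mu_J2 c2) must be definable in C with parameters.

    Here c1 is a tuple of J1-codes and c2 a tuple of J2-codes.  The relation
    holds exactly when c1 and c2 lie in the domains of the composites and some
    tuple t of J2-codes satisfies two conditions.
    - Blockwise, c1 and t represent the same tuple of elements of B.  The
      connector from J1 to J2, applied to each block, expresses this.
    - The tuples of B represented by t and c2 represent the same element of A.
      The connector from I1 to I2 defines this in B, and its translation along
      J2, with its parameters replaced by codes, defines it in C
      ([definable_pullback]).
    Such a t exists whenever the relation holds because mu_J2 is surjective.

    That the composites are interpretations ([comp_pulls_back]) follows from the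
    reduction property of translations: the translation of a formula holds at
    tuples of the domain exactly when the formula holds at the elements that
    they represent ([sat_tr_nform], [sat_translate]). *)

(** * Interpretations as pullbacks along the coordinate map *)

Section Pullback.
Variables (L L' : language) (A : structure L) (B : structure L').
Variable I : interp_triple A B.
Local Notation p := (ipar I).
Local Notation mu := (icoord I).

Definition point_assign (V : Type) (bs : V -> domU p) :
    cvar (dim (icode I)) (dimpar (icode I)) V -> B :=
  assign (fun v => sval (bs v)) p.

(** The index type V ranges over all types so that an atom may repeat variables
    and may be read inside a larger formula. *)
Definition pulls_back : Prop :=
  (forall a : A, exists b : domU p, mu (sval b) = a) /\
  (forall (V : Type) (a : atom L V) (bs : V -> domU p),
     sat (tr_atom (icode I) a) (point_assign bs)
     <-> sat (atom_formula a) (fun v => mu (sval (bs v)))).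

Lemma sat_inst (W V : Type) (h : W -> V) phi (X : V -> 'I_(dim (icode I)) -> B) :
  sat (rename (inst h) phi) (assign X p) <-> sat phi (assign (fun w => X (h w)) p).
Proof.
rewrite sat_rename; set r1 := (fun v => _).
by suff -> : r1 = assign (fun w => X (h w)) p by []; apply: funext => -[[]|].
Qed.

Lemma class_eq (b b' : domU p) : simE b = simE b' -> class b = class b'.
Proof.
rewrite /class; move: (ex_intro _ _ _) (ex_intro _ _ _) => + + E.
by rewrite E => h h'; rewrite (Prop_irrelevance h h').
Qed.

Lemma class_eqP (wd : well_defined p) (b b' : domU p) :
  class b = class b' <-> simE b b'.
Proof.
split=> [/(congr1 sval) /= -> |bb']; first exact: wd_refl.
apply/class_eq/funext => c; apply: propext.
split; last exact: (wd_trans wd).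
exact/(wd_trans wd)/(wd_sym wd).
Qed.

Lemma class_repr (s : quoU p) : class (repr s) = s.
Proof.
rewrite /repr; case: cid => b /= E; case: s E => S h /= E; subst S.
by rewrite /class; congr exist; apply: Prop_irrelevance.
Qed.

(** The induced map is injective and compatible with the symbols, so what the
    code says about classes is what holds of their images in A. *)
Lemma pulls_back_interpretation : is_interpretation I -> pulls_back.
Proof.
move=> [wd [surj ind [bij_mu mu_c mu_f mu_R]]]; split=> // V.
have inj := bij_inj bij_mu.
case=> [x x'|x c|f xs x0|R xs] bs; rewrite /= sat_inst.
- set r := assign _ _.
  have -> : r = assign (fun s : bool => sval (if s then bs x' else bs x)) p.
    by congr assign; apply: funext => -[].
  rewrite -/(simE _ _) -(class_eqP wd); split=> [E|]; first by rewrite -!ind E.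
  by rewrite -!ind => /inj.
- have := svalP (cid (wd_c wd c)) (bs x); rewrite /= => ->.
  rewrite -ind -mu_c; split=> [->//|]; exact: inj.
- have := svalP (cid (wd_f wd f)) (bs x0) (fun i => bs (xs i)).
  have -> : (fun v => sval (oapp (fun i => bs (xs i)) (bs x0) v)) =
            (fun w => sval (bs (oapp xs x0 w))).
    by apply: funext => -[].
  rewrite /= => ->; rewrite -ind.
  have -> : (fun i => mu (sval (bs (xs i)))) =
            (fun i => induced_map I (class (bs (xs i)))).
    by apply: funext => i; rewrite ind.
  rewrite -mu_f; split=> [->//|/esym]; exact: inj.
- have := svalP (cid (wd_R wd R)) (fun i => bs (xs i)); rewrite /= => ->.
  have -> : (fun i => mu (sval (bs (xs i)))) =
            (fun i => induced_map I (class (bs (xs i)))).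
    by apply: funext => i; rewrite ind.
  exact: mu_R.
Qed.

Section Converse.
Hypothesis pb : pulls_back.

Let pick (a : A) : domU p := sval (cid (pb.1 a)).
Let pickE a : mu (sval (pick a)) = a. Proof. by rewrite /pick; case: cid. Qed.

Let simP (b b' : domU p) : simE b b' <-> mu (sval b) = mu (sval b').
Proof.
have := pb.2 _ (AEq false true) (fun s : bool => if s then b' else b).
rewrite /= sat_inst => <-; rewrite /simE.
set r := assign _ _; set r' := assign _ _.
by suff -> : r = r' by []; congr assign; apply: funext => -[].
Qed.

Let classP (b b' : domU p) : class b = class b' <-> mu (sval b) = mu (sval b').
Proof.
split=> [/(congr1 sval) /= E|E]; first by apply/simP; rewrite E; apply/simP.
by apply/class_eq/funext => c; apply: propext; rewrite !simP E.
Qed.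

Let indE (b : domU p) : induced_map I (class b) = mu (sval b).
Proof. by apply/classP; rewrite class_repr. Qed.

Let indsE n (bs : 'I_n -> domU p) :
  (fun i => induced_map I (class (bs i))) = (fun i => mu (sval (bs i))).
Proof. by apply: funext => i. Qed.

Let ind_inj : injective (induced_map I).
Proof.
by move=> s s'; rewrite -(class_repr s) -(class_repr s') !indE => /classP.
Qed.

Let def_c (c : csym L) : defines_constant c (class (pick (cint A c))).
Proof.
move=> b; have := pb.2 _ (ACst tt c) (fun=> b).
by rewrite /= sat_inst => ->; rewrite classP pickE.
Qed.

Let def_f (f : fsym L) : @defines_operation _ _ _ _ p f
  (fun ss => class (pick (fint (fun i => induced_map I (ss i))))).
Proof.
move=> b0 bs.
have := pb.2 _ (@AFun L (option 'I_(farity f)) f Some None) (oapp bs b0).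
rewrite /= sat_inst.
have -> : (fun w => sval (oapp bs b0 (oapp Some None w))) =
          (fun w => sval (oapp bs b0 w)) by apply: funext => -[].
move=> ->; rewrite classP pickE indsE.
by split=> ->.
Qed.

Let def_R (R : psym L) : @defines_relation _ _ _ _ p R
  (fun ss => pint (fun i => induced_map I (ss i))).
Proof.
move=> bs; have := pb.2 _ (@APred L 'I_(parity R) R id) bs.
by rewrite /= sat_inst => ->; rewrite indsE.
Qed.

(** Equality of images is an equivalence relation, so E is one, and constants,
    operations and relations on the quotient are those of A transported along
    [pick]. *)
Lemma interpretation_of_pullback : is_interpretation I.
Proof.
have wd : well_defined p.
  split.
  - by have [a] := carrier_inh A; constructor; apply: pick.
  - by move=> b; apply/simP.
  - by move=> b b' /simP E; apply/simP.
  - by move=> b b' b'' /simP E /simP E'; apply/simP; rewrite E.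
  - by move=> c; exists (class (pick (cint A c))).
  - by move=> f; exists (fun ss => class (pick (fint (fun i => induced_map I (ss i))))).
  - by move=> R; exists (fun ss => pint (fun i => induced_map I (ss i))).
exists wd; split; [exact: pb.1 | exact: indE | split].
- exists (fun a => class (pick a)) => [s|a]; last by rewrite indE pickE.
  by apply: ind_inj; rewrite indE pickE.
- move=> c /=; case: cid => s /= Hs.
  have <- : class (pick (cint A c)) = s by apply/Hs/def_c.
  by rewrite indE pickE.
- move=> f ss /=; case: cid => op /= Hop.
  set b0 := pick (fint (fun i => induced_map I (ss i))).
  have : class b0 = op (fun i => class (repr (ss i))).
    apply/Hop/def_f; congr (class (pick (fint _))); apply: funext => i.
    by rewrite class_repr.
  have -> : (fun i => class (repr (ss i))) = ss by apply: funext => i; rewrite class_repr.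
  by move=> <-; rewrite indE pickE.
- move=> R ss /=; case: cid => rel /= Hrel.
  have := Hrel (fun i => repr (ss i)).
  have -> : (fun i => class (repr (ss i))) = ss by apply: funext => i; rewrite class_repr.
  move=> <-; rewrite (def_R _).
  by under eq_fun do rewrite class_repr.
Qed.

End Converse.

(** This criterion removes the quotients, which allows composites to be checked
    on tuples alone. *)
Lemma is_interpretationP : is_interpretation I <-> pulls_back.
Proof.
split; [exact: pulls_back_interpretation | exact: interpretation_of_pullback].
Qed.

End Pullback.

(** * Translations *)

Definition join_assign (V W X : Type) (r : V -> X) (t : W -> X) : V + W -> X :=
  fun v => match v with inl x => r x | inr y => t y end.

Section TupleQuantifiers.
Variables (L : language) (M : structure L).

Lemma join_assign0 (V : Type) (rho : V -> M) (t : 'I_0 -> M) :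
  join_assign rho t = (fun v => rho (unblock0 v)).
Proof. by apply: funext => -[|[]]. Qed.

Lemma join_assignS (V : Type) n (rho : V -> M) (t : 'I_n.+1 -> M) :
  (fun v => join_assign (extend rho (t ord0)) (fun i => t (lift ord0 i)) (unblockS v))
  = join_assign rho t.
Proof. by apply: funext => -[x|i] //=; case: unliftP => [j|] ->. Qed.

Definition ord_cons n (a : M) (t : 'I_n -> M) (i : 'I_n.+1) : M :=
  oapp t a (unlift ord0 i).

Lemma ord_consK n a (t : 'I_n -> M) (V : Type) (rho : V -> M) :
  (fun v => join_assign (extend rho a) t (unblockS v)) = join_assign rho (ord_cons a t).
Proof.
rewrite -join_assignS /ord_cons unlift_none /=.
by apply: funext => v; congr join_assign; apply: funext => i; rewrite liftK.
Qed.

Lemma sat_Exn n : forall (V : Type) (phi : formula L (V + 'I_n)) (rho : V -> M),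
  sat (Exn phi) rho <-> exists t : 'I_n -> M, sat phi (join_assign rho t).
Proof.
elim: n => [|n IH] V phi rho /=.
  rewrite sat_rename; split=> [H|[t]]; last by rewrite join_assign0.
  by exists (fun i => rho (unblock0 (inr i))); rewrite join_assign0.
split=> [[a /IH [t]]|[t H]].
  by rewrite sat_rename ord_consK; exists (ord_cons a t).
exists (t ord0); apply/IH; exists (fun i => t (lift ord0 i)).
by rewrite sat_rename join_assignS.
Qed.

Lemma sat_Alln n : forall (V : Type) (phi : formula L (V + 'I_n)) (rho : V -> M),
  sat (Alln phi) rho <-> forall t : 'I_n -> M, sat phi (join_assign rho t).
Proof.
elim: n => [|n IH] V phi rho /=.
  rewrite sat_rename; split=> [H t|/(_ (fun i => rho (unblock0 (inr i))))].
    by rewrite join_assign0.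
  by rewrite join_assign0.
split=> [H t|H a].
  by have /IH/(_ (fun i => t (lift ord0 i))) := H (t ord0);
    rewrite sat_rename join_assignS.
by apply/IH => t; rewrite sat_rename ord_consK.
Qed.

End TupleQuantifiers.

Section TranslationSemantics.
Variables (L L' : language) (A : structure L) (B : structure L').
Variable I : interp_triple A B.
Hypothesis pb : pulls_back I.
Local Notation p := (ipar I).
Local Notation mu := (icoord I).

Lemma sat_tr_U (V : Type) (x : V) (X : V -> 'I_(dim (icode I)) -> B) :
  sat (tr_U (icode I) x) (assign X p) <-> in_U p (X x).
Proof. exact: sat_inst. Qed.

(** Literals may be negated here because all the tuples lie in the domain: there
    the translated atoms are exact in both directions. *)
Lemma sat_tr_disjunction (V : Type) (e : disjunction L V) (bs : V -> domU p) :
  sat (tr_disjunction (icode I) e) (point_assign bs)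
  <-> sat (disjunction_formula e) (fun v => mu (sval (bs v))).
Proof.
elim: e => [k|e1 IH1 e2 IH2] /=; last by rewrite IH1 IH2.
elim: k => [l|k1 IH1 k2 IH2] /=; last by rewrite IH1 IH2.
by case: l => a /=; rewrite pb.2.
Qed.

Lemma isolate_assign (V : Type) (bs : V -> domU p) (b : domU p) :
  (fun v => join_assign (point_assign bs) (sval b) (isolate v))
  = point_assign (extend bs b).
Proof. by apply: funext => -[[[x|] i]|j]. Qed.

Lemma sat_tr_block (V : Type) (bs : V -> domU p)
    (t : 'I_(dim (icode I)) -> B) :
  sat (tr_U (icode I) None)
    (fun v => join_assign (point_assign bs) t (@isolate _ _ (icode I) V v))
  <-> in_U p t.
Proof.
rewrite -(@sat_tr_U (option V) None (extend (fun v => sval (bs v)) t)).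
by set r := (fun v => _); suff -> : r = assign (extend (fun v => sval (bs v)) t) p
  by []; apply: funext => -[[[x|] i]|j].
Qed.

(** Reduction property.  A relativized quantifier over tuples of U matches a
    quantifier over A since mu maps U onto A.  V may be infinite, so that it can
    contain all elements of B as parameters. *)
Lemma sat_tr_nform (V : Type) (psi : nform L V) (bs : V -> domU p) :
  sat (tr_nform (icode I) psi) (point_assign bs)
  <-> sat (nform_formula psi) (fun v => mu (sval (bs v))).
Proof.
have ext (W : Type) (cs : W -> domU p) b :
    (fun v => mu (sval (extend cs b v))) =
    extend (fun v => mu (sval (cs v))) (mu (sval b)) by apply: funext => -[].
have sat_isolate (W : Type) chi rho : sat (rename (@isolate _ _ (icode I) W) chi) rho <->
    sat chi (fun v => rho (isolate v)) by exact: sat_rename.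
elim: psi bs => {V} [V e|V psi IH|V psi IH] bs.
- exact: sat_tr_disjunction.
- rewrite /= sat_Exn; split=> [[t]|[a H]].
    rewrite /= !sat_isolate => -[/sat_tr_block Ht].
    rewrite -[t]/(sval (exist (in_U p) t Ht)) isolate_assign IH ext => H.
    by eexists; exact: H.
  have [b Eb] := pb.1 a; exists (sval b); rewrite /= !sat_isolate; split.
    by apply/sat_tr_block => //; exact: svalP.
  by rewrite isolate_assign IH ext Eb.
- rewrite /= sat_Alln; split=> [H a|H t].
    have [b <-] := pb.1 a; move: (H (sval b)); rewrite /= !sat_isolate.
    move=> /(_ (proj2 (sat_tr_block _ _) (svalP b))).
    by rewrite isolate_assign IH ext.
  rewrite /= !sat_isolate => /sat_tr_block Ht.
  by rewrite -[t]/(sval (exist (in_U p) t Ht)) isolate_assign IH ext.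
Qed.

(** The conjuncts U added for the free variables force all tuples into the
    domain, so this equivalence holds for arbitrary tuples. *)
Lemma sat_translate (V : finType) (psi : nform L V)
    (X : V -> 'I_(dim (icode I)) -> B) :
  sat (translate (icode I) psi) (assign X p)
  <-> (forall v, in_U p (X v)) /\ sat (nform_formula psi) (fun v => mu (X v)).
Proof.
have H (s : seq V) chi :
  sat (foldl (fun chi x => And chi (tr_U (icode I) x)) chi s) (assign X p)
  <-> (forall v, v \in s -> in_U p (X v)) /\ sat chi (assign X p).
  elim: s chi => [|x s IH] chi /=; first by split=> [|[]].
  rewrite IH /= sat_tr_U; split=> [[Hs [Hchi Hx]]|[Hs Hchi]].
    by split=> // v; rewrite inE => /predU1P[->|/Hs].
  by split; [move=> v vs; apply: Hs|split=> //; apply: Hs]; rewrite inE ?vs ?eqxx ?orbT.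
rewrite H; split=> [[Hs Hpsi]|[Hs Hpsi]].
  have HX v : in_U p (X v) by apply: Hs; rewrite mem_enum.
  split=> //; exact/(sat_tr_nform psi (fun v => exist _ (X v) (HX v))).
split=> //; exact/(sat_tr_nform psi (fun v => exist _ (X v) (Hs v))).
Qed.

End TranslationSemantics.

(** * Composition of interpretations *)

Section Composition.
Variables (LA LB LC : language).
Variables (A : structure LA) (B : structure LB) (C : structure LC).
Variables (I : interp_triple A B) (J : interp_triple B C) (N : normalizer LB).
Variable pp : 'I_(dimpar (icode I) * dim (icode J)) -> C.
Hypotheses (pbI : pulls_back I) (pbJ : pulls_back J).
Hypothesis lift_pp : lifts J (ipar I) pp.
Local Notation IJ := (comp_triple N I J pp).

(** [mxvec_index] is how composite codes flatten a tuple of m tuples of length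
    n. *)
Definition block (m n : nat) (X : Type) (c : 'I_(m * n) -> X)
    (i : 'I_m) (j : 'I_n) : X :=
  c (mxvec_index i j).

Definition coords (c : 'I_(dim (icode I) * dim (icode J)) -> C) :
    'I_(dim (icode I)) -> B :=
  fun i => icoord J (block c i).

(** The parameters of the outer code are variables of the translated formula, so
    the translation also demands that their codes lie in the domain; this is
    what [lift_pp] provides, together with their values. *)
Lemma sat_comp_formula (W : finType)
    (phi : formula LB (cvar (dim (icode I)) (dimpar (icode I)) W))
    (cs : W -> 'I_(dim (icode I) * dim (icode J)) -> C) :
  sat (comp_formula N (icode J) phi) (assign cs (ipar IJ))
  <-> (forall w i, in_U (ipar J) (block (cs w) i))
      /\ sat phi (assign (fun w => coords (cs w)) (ipar I)).
Proof.
rewrite /comp_formula sat_rename.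
pose X (x : (W * 'I_(dim (icode I))) + 'I_(dimpar (icode I))) :=
  match x with inl (w, i) => block (cs w) i | inr l => block pp l end.
set r := (fun v => _); have -> : r = assign X (ipar J).
  apply: funext => -[[[[w i]|l] j]|l] //; rewrite /r /=.
    by rewrite -[lshift _ _]/(unsplit (inl _)) unsplitK.
  by rewrite -[rshift _ _]/(unsplit (inr _)) unsplitK.
rewrite sat_translate // -(nf_equivalent N phi).
set r1 := (fun v => _); have -> : r1 = assign (fun w => coords (cs w)) (ipar I).
  by apply: funext => -[[w i]|l] //; rewrite /r1 /=; case: (lift_pp l).
split=> -[H Hphi]; split=> //; first by move=> w i; apply: (H (inl (w, i))).
by case=> [[w i]|l]; [apply: H | case: (lift_pp l)].
Qed.

Lemma in_U_comp (c : 'I_(dim (icode I) * dim (icode J)) -> C) :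
  in_U (ipar IJ) c
  <-> (forall i, in_U (ipar J) (block c i)) /\ in_U (ipar I) (coords c).
Proof.
rewrite /in_U (sat_comp_formula _ (fun=> c)).
by split=> -[H ?]; split=> // i; apply: (H tt).
Qed.

(** An atom of A at a point of the composite translates twice: the outer code
    turns it into a formula about the tuple of B that the point represents, and
    the reduction property turns that into the formula of the composite code. *)
Lemma comp_pulls_back : pulls_back IJ.
Proof.
split=> [a|V a bs].
  have [b <-] := pbI.1 a.
  pose c i := sval (cid (pbJ.1 (sval b i))).
  (* The codes of the entries of b, flattened: [mxvec] inverts [block]. *)
  pose cc k := (mxvec (\matrix_(i, j) sval (c i) j)%R) ord0 k.
  have blk i : block cc i = sval (c i).
    by apply: funext => j; rewrite /block /cc mxvecE mxE.
  have crd : coords cc = sval b.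
    by apply: funext => i; rewrite /coords blk /c; case: cid.
  have Ucc : in_U (ipar IJ) cc.
    by apply/in_U_comp; split=> [i|]; rewrite ?blk ?crd; apply: svalP.
  by exists (exist _ cc Ucc); rewrite /= -/(coords cc) crd.
have UbJ v i : in_U (ipar J) (block (sval (bs v)) i).
  by have /in_U_comp[] := svalP (bs v).
have UbI v : in_U (ipar I) (coords (sval (bs v))).
  by have /in_U_comp[] := svalP (bs v).
rewrite -[X in _ <-> X](pbI.2 _ a (fun v => exist _ _ (UbI v))).
case: a => [x x'|x c|f xs x0|R xs]; rewrite /= sat_inst;
  by rewrite (sat_inst (I := IJ)) sat_comp_formula; split=> [[]|].
Qed.

End Composition.

(** * Strong homotopies as definability of having the same image *)

Section Homotopy.
Variables (L L' : language) (A : structure L) (B : structure L').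
Variables I1 I2 : interp_triple A B.

Definition same_point (b1 : 'I_(dim (icode I1)) -> B) (b2 : 'I_(dim (icode I2)) -> B) :=
  [/\ in_U (ipar I1) b1, in_U (ipar I2) b2 & icoord I1 b1 = icoord I2 b2].

(** The parameters of a formula are the elements of the structure themselves,
    used as variables. *)
Definition with_params (V X : Type) (rho : V -> X) : V + X -> X :=
  fun v => match v with inl x => rho x | inr r => r end.

Lemma iso_comp (M N P : structure L) (f : M -> N) (g : N -> P) :
  isomorphism f -> isomorphism g -> isomorphism (g \o f).
Proof.
move=> [bf cf ff rf] [bg cg fg rg]; split=> [|c|F xs|R xs] /=.
- exact: bij_comp.
- by rewrite cf cg.
- by rewrite ff fg.
- by rewrite rf rg.
Qed.

Lemma iso_inv (M N : structure L) (f : M -> N) (g : N -> M) :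
  isomorphism f -> cancel f g -> cancel g f -> isomorphism g.
Proof.
move=> [bf cf ff rf] fK gK; split=> [|c|F xs|R xs] /=.
- by exists f.
- by rewrite -cf fK.
- by rewrite -[RHS]fK ff; congr (g (fint _)); apply: funext => i; rewrite gK.
- by rewrite rf; under [in X in _ <-> X]eq_fun do rewrite gK.
Qed.

(** Commutation with the induced maps determines the isomorphism, and hence the
    relation that a connector defines; conversely the inverse of the second
    induced map after the first one is always an isomorphism over A. *)
Lemma strong_homotopyP (theta : connector I1 I2) :
  strong_homotopy theta <->
  [/\ is_interpretation I1, is_interpretation I2
    & forall b1 b2, sat theta (with_params (join_assign b1 b2)) <-> same_point b1 b2].
Proof.
have asgE b1 b2 : with_params (join_assign b1 b2) =
    (fun v : ('I_(dim (icode I1)) + 'I_(dim (icode I2))) + B => match v with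
       | inl (inl i) => b1 i | inl (inr j) => b2 j | inr r => r end).
  by apply: funext => -[[]|].
split=> [[int1 int2 [wd1 [wd2 [lam [_ comm def]]]]]|[int1 int2 def]]; split=> //.
  have [_ [_ ind1 _]] := int1; have [wd2' [_ ind2 [/bij_inj inj2 _ _ _]]] := int2.
  move=> b1 b2; rewrite asgE def; split=> [[h1 [h2 E]]|[h1 h2 E]].
    split=> //; have := ind1 (exist _ b1 h1); rewrite /= => <-.
    by rewrite comm E ind2.
  exists h1, h2; apply: inj2; rewrite -comm.
  by have := ind1 (exist _ b1 h1); rewrite ind2 /= => ->.
have [wd1 [_ ind1 iso1]] := int1; have [wd2 [_ ind2 iso2]] := int2.
have [[g gK1 gK2] _ _ _] := iso2.
exists wd1, wd2, (g \o induced_map I1); split.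
- exact/iso_comp/(iso_inv iso2).
- by move=> s /=; rewrite gK2.
- move=> b1 b2; rewrite -asgE def; split=> [[h1 h2 E]|[h1 [h2 E]]].
    by exists h1, h2; apply: (can_inj gK1); rewrite /= gK2 ind1 ind2.
  split=> //; move/(congr1 (induced_map I2)): E; rewrite /= gK2.
  by rewrite ind1 ind2.
Qed.

End Homotopy.

(** * Relations definable with parameters *)

Section Definable.
Variables (L : language) (M : structure L).

Definition definable (V : Type) (P : (V -> M) -> Prop) : Prop :=
  exists phi : formula L (V + M),
    forall rho : V -> M, sat phi (with_params rho) <-> P rho.

Lemma definable_ext (V : Type) (P Q : (V -> M) -> Prop) :
  definable P -> (forall rho, P rho <-> Q rho) -> definable Q.
Proof. by move=> [phi H] PQ; exists phi => rho; rewrite H. Qed.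

Lemma definable_sat (V W : Type) (phi : formula L W) (h : W -> V + M) :
  definable (fun rho : V -> M => sat phi (fun w => with_params rho (h w))).
Proof. by exists (rename h phi) => rho; rewrite sat_rename. Qed.

Lemma definable_in_U (L0 : language) (A : structure L0) (I : interp_triple A M)
    (V : Type) (h : 'I_(dim (icode I)) -> V) :
  definable (fun rho : V -> M => in_U (ipar I) (fun i => rho (h i))).
Proof.
pose h' (v : cvar (dim (icode I)) (dimpar (icode I)) unit) : V + M :=
  match v with inl (_, i) => inl (h i) | inr j => inr (ipar I j) end.
apply: definable_ext (definable_sat (code_U (icode I)) h') _ => rho.
rewrite /in_U; set r := (fun v => _); set r' := assign _ _.
by suff -> : r = r' by []; apply: funext => -[[]|].
Qed.

Lemma definable_reindex (V W : Type) (P : (W -> M) -> Prop) (h : W -> V) :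
  definable P -> definable (fun rho : V -> M => P (fun w => rho (h w))).
Proof.
move=> [phi H].
pose h' (w : W + M) : V + M := match w with inl x => inl (h x) | inr r => inr r end.
apply: definable_ext (definable_sat phi h') _ => rho; rewrite -H.
by set r := (fun w => _); suff -> : r = with_params (fun w => rho (h w)) by [];
  apply: funext => -[].
Qed.

Lemma definable_and (V : Type) (P Q : (V -> M) -> Prop) :
  definable P -> definable Q -> definable (fun rho => P rho /\ Q rho).
Proof. by move=> [phi H] [psi K]; exists (And phi psi) => rho /=; rewrite H K. Qed.

Lemma definable_true (V : Type) : definable (fun _ : V -> M => True).
Proof.
have [m] := carrier_inh M.
by exists (Eq (Var (inr m)) (Var (inr m))) => rho /=.
Qed.

Lemma definable_all (V : Type) n (P : 'I_n -> (V -> M) -> Prop) :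
  (forall i, definable (P i)) -> definable (fun rho => forall i, P i rho).
Proof.
elim: n P => [|n IH] P H.
  by apply: definable_ext (definable_true V) _; split=> // _ [].
apply: definable_ext (definable_and (H ord0) (IH _ (fun i => H (lift ord0 i)))) _.
move=> rho; split=> [[H0 H1] i|Hi]; last by split.
by case: (unliftP ord0 i) => [j|] ->.
Qed.

Lemma definable_ex (V : Type) n (P : (V + 'I_n -> M) -> Prop) :
  definable P -> definable (fun rho => exists t : 'I_n -> M, P (join_assign rho t)).
Proof.
move=> [phi H].
pose h (v : (V + 'I_n) + M) : (V + M) + 'I_n :=
  match v with
  | inl (inl x) => inl (inl x)
  | inl (inr i) => inr i
  | inr r => inl (inr r)
  end.
exists (Exn (rename h phi)) => rho; rewrite sat_Exn.
have E t : sat (rename h phi) (join_assign (with_params rho) t) <-> P (join_assign rho t).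
  rewrite sat_rename -H; set r := (fun v => _).
  by suff -> : r = with_params (join_assign rho t) by []; apply: funext => -[[]|].
by split=> -[t /E Ht]; exists t.
Qed.

End Definable.

(** Definability transfers along an interpretation: translate a normal form of
    the defining formula and replace each parameter b from B by the entries of a
    tuple that represents b.  Outside the domain the truth value of Q is left
    open. *)
Lemma definable_pullback (L L' : language) (B : structure L) (C : structure L')
    (J : interp_triple B C) (V : Type) (P : (V -> B) -> Prop) :
  pulls_back J -> definable P ->
  exists Q : (V * 'I_(dim (icode J)) -> C) -> Prop,
    definable Q /\
    forall cs : V -> domU (ipar J),
      Q (fun v => sval (cs v.1) v.2) <-> P (fun v => icoord J (sval (cs v))).
Proof.
move=> pb [phi H]; have [psi Hpsi] := nf_exists phi.
pose pre b := sval (cid (pb.1 b)).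
have preE b : icoord J (sval (pre b)) = b by rewrite /pre; case: cid.
pose h (v : cvar (dim (icode J)) (dimpar (icode J)) (V + B)) :
    V * 'I_(dim (icode J)) + C :=
  match v with
  | inl (inl x, i) => inl (x, i)
  | inl (inr b, i) => inr (sval (pre b) i)
  | inr j => inr (ipar J j)
  end.
exists (fun rho => sat (tr_nform (icode J) psi) (fun v => with_params rho (h v))).
split=> [|cs]; first exact: definable_sat.
pose cs' (v : V + B) := match v with inl x => cs x | inr b => pre b end.
set r := (fun v => _); have -> : r = point_assign cs'.
  by apply: funext => -[[[x|b] i]|j].
rewrite sat_tr_nform // Hpsi -H; set r1 := (fun v => _); set r2 := with_params _.
by suff -> : r1 = r2 by []; apply: funext => -[x|b] //; apply: preE.
Qed.

(** * Composition of strong homotopies *)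

Theorem proposition8 (LA LB LC : language)
    (A : structure LA) (B : structure LB) (C : structure LC)
    (I1 I2 : interp_triple A B) (thetaAB : connector I1 I2)
    (J1 J2 : interp_triple B C) (thetaBC : connector J1 J2)
    (N1 N2 : normalizer LB)
    (pp1 : 'I_(dimpar (icode I1) * dim (icode J1)) -> C)
    (pp2 : 'I_(dimpar (icode I2) * dim (icode J2)) -> C) :
  strong_homotopy thetaAB ->
  strong_homotopy thetaBC ->
  lifts J1 (ipar I1) pp1 ->
  lifts J2 (ipar I2) pp2 ->
  exists theta : connector (comp_triple N1 I1 J1 pp1)
                           (comp_triple N2 I2 J2 pp2),
    strong_homotopy theta.
Proof.
move=> /strong_homotopyP[/is_interpretationP pI1 /is_interpretationP pI2 defAB].
move=> /strong_homotopyP[/is_interpretationP pJ1 /is_interpretationP pJ2 defBC].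
move=> lift1 lift2.
pose K1 := comp_triple N1 I1 J1 pp1; pose K2 := comp_triple N2 I2 J2 pp2.
suff [theta Htheta] : definable
    (fun rho : 'I_(dim (icode K1)) + 'I_(dim (icode K2)) -> C =>
      same_point (fun i => rho (inl i)) (fun j => rho (inr j)) : Prop).
  exists theta; apply/strong_homotopyP; split=> [||b1 b2].
  - by apply/is_interpretationP/comp_pulls_back.
  - by apply/is_interpretationP/comp_pulls_back.
  - exact: (Htheta (join_assign b1 b2)).
have defP : definable (fun rho : 'I_(dim (icode I1)) + 'I_(dim (icode I2)) -> B =>
    same_point (fun i => rho (inl i)) (fun j => rho (inr j)) : Prop).
  exists thetaAB => rho; rewrite -defAB; set r := with_params _; set r' := with_params _.
  by suff -> : r = r' by []; apply: funext => -[[]|].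
have [Q [defQ HQ]] := definable_pullback pJ2 defP.
(* The summands are the entries of c1, c2 and of the intermediate tuple t. *)
pose V := (('I_(dim (icode K1)) + 'I_(dim (icode K2)))
           + 'I_(dim (icode I1) * dim (icode J2)))%type.
have defBlocks : definable (fun rho : V -> C => forall i : 'I_(dim (icode I1)),
    same_point (I1 := J1) (I2 := J2) (fun j => rho (inl (inl (mxvec_index i j))))
      (fun j => rho (inr (mxvec_index i j)))).
  apply: definable_all => i.
  pose h (v : ('I_(dim (icode J1)) + 'I_(dim (icode J2))) + C) : V + C :=
    match v with
    | inl (inl j) => inl (inl (inl (mxvec_index i j)))
    | inl (inr j) => inl (inr (mxvec_index i j))
    | inr c => inr c
    end.
  apply: definable_ext (definable_sat thetaBC h) _ => rho; rewrite -defBC.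
  set r := (fun v => _); set r' := with_params _.
  by suff -> : r = r' by []; apply: funext => -[[]|].
pose h (v : ('I_(dim (icode I1)) + 'I_(dim (icode I2))) * 'I_(dim (icode J2))) : V :=
  match v with
  | (inl i, j) => inr (mxvec_index i j)
  | (inr i, j) => inl (inr (mxvec_index i j))
  end.
have defE := definable_ex (definable_and defBlocks (definable_reindex h defQ)).
have defU1 := definable_in_U (I := K1) (@inl _ 'I_(dim (icode K2))).
have defU2 := definable_in_U (I := K2) (@inr 'I_(dim (icode K1)) _).
apply: definable_ext (definable_and defU1 (definable_and defU2 defE)) _ => rho.
set c1 := (fun i => rho (inl i)); set c2 := (fun j => rho (inr j)).
(* Once t represents the same tuple of B as c1, the pulled-back connector
   compares the images of c1 and c2 in A. *)
have transport t : in_U (ipar K1) c1 -> in_U (ipar K2) c2 ->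
    (forall i, same_point (I1 := J1) (I2 := J2) (block c1 i) (block t i)) ->
    Q (fun w => join_assign rho t (h w)) <-> icoord K1 c1 = icoord K2 c2.
  move=> /(in_U_comp _ pJ1 lift1)[_ UI1] /(in_U_comp _ pJ2 lift2)[UJ2 UI2] bl.
  have Ut i : in_U (ipar J2) (block t i) by case: (bl i).
  pose cs (v : 'I_(dim (icode I1)) + 'I_(dim (icode I2))) : domU (ipar J2) :=
    match v with inl i => exist _ _ (Ut i) | inr i => exist _ _ (UJ2 i) end.
  have -> : (fun w => join_assign rho t (h w)) = (fun v => sval (cs v.1) v.2).
    by apply: funext => -[[i|i] j].
  rewrite HQ.
  have -> : (fun i => icoord J2 (sval (cs (inl i)))) = coords (I := I1) (J := J1) c1.
    by apply: funext => i; case: (bl i) => _ _ E; exact: esym E.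
  by split=> [[]|].
split=> [[U1 [U2 [t [bl HQt]]]]|[U1 U2 E]].
  by split=> //; apply/(transport t).
split=> //; split=> //.
(* A J2-code is chosen for each element of B that a block of c1 represents. *)
have [UJ1 _] := (in_U_comp _ pJ1 lift1 c1).1 U1.
pose c i := sval (cid (pJ2.1 (icoord J1 (block c1 i)))).
pose t k := (mxvec (\matrix_(i, j) sval (c i) j)%R) ord0 k.
have blk i : block t i = sval (c i).
  by apply: funext => j; rewrite /block /t mxvecE mxE.
have bl i : same_point (I1 := J1) (I2 := J2) (block c1 i) (block t i).
  split=> //; rewrite blk; first exact: svalP.
  by rewrite /c; case: cid.
by exists t; split=> //; apply/transport.
Qed.
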